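(* Let $\Gamma$ be a constraint language that is neither strictly essentially positive nor strictly essentially negative. Then the binary equality relation $(x=y)$ belongs to $\langle\Gamma\rangle_{\neq}$, and $\langle\Gamma\rangle=\langle\Gamma\rangle_{\neq}$.
   Context: A logical relation of arity $k$ is a set $R\subseteq\{0,1\}^k$; a constraint is $R(x_1,\dots,x_k)$ with not necessarily distinct variables $x_i$. A constraint language is a finite set $\Gamma$ of logical relations; a $\Gamma$-formula is a (finite) conjunction of constraints over relations in $\Gamma$. $\langle\Gamma\rangle$ is the set of relations that can be expressed as a $\Gamma\cup\{=\}$-formula with existentially quantified variables, i.e. $R(x_1,\dots,x_n)\equiv\exists y_1\dots\exists y_l\,\phi(x_1,\dots,x_n,y_1,\dots,y_l)$ with $\phi$ a $\Gamma\cup\{=\}$-formula. $\langle\Gamma\rangle_{\neq}$ is the set of relations that can be expressed as a $\Gamma$-formula with existentially quantified variables (the equality relation is not allowed). A relation is strictly essentially positive (strictly essentially negative) if it is definable by a conjunction of literals and positive clauses (of literals and negative clauses) only. A constraint language has one of these properties if all its relations have it. *)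

(* Defs.v *)
From mathcomp Require Import all_boot finmap.

Set Implicit Arguments.
Unset Strict Implicit.
Unset Printing Implicit Defensive.

Local Open Scope fset_scope.

Definition logical_relation := {k : nat & {set k.-tuple bool}}.

Definition arity (R : logical_relation) : nat := tag R.

Definition holds (R : logical_relation) (x : (arity R).-tuple bool) : bool :=
  x \in tagged R.

Definition eq_relation : logical_relation :=
  Tagged (fun k => {set k.-tuple bool})
    [set x : 2.-tuple bool | tnth x ord0 == tnth x ord_max].

Definition constraint_language := {fset logical_relation}.

(* A constraint R(x_1, ..., x_k) over the variables 'I_n; the argument tuple
   may repeat variables. *)
Record constraint (n : nat) := Constraint {
  crel : logical_relation;
  cargs : (arity crel).-tuple 'I_n
}.

Definition csat n (s : n.-tuple bool) (c : constraint n) : bool :=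
  holds [tuple tnth s (tnth (cargs c) j) | j < arity (crel c)].

(* A list of constraints is read as their conjunction; [::] is true. *)
Definition formula (n : nat) := seq (constraint n).

Definition fsat n (s : n.-tuple bool) (phi : formula n) : bool :=
  all (csat s) phi.

Definition formula_over (Gamma : constraint_language) n (phi : formula n) :
  bool := all (fun c => crel c \in Gamma) phi.

(* <Gamma>_{<>}: in a formula over n + l variables, the first n are the free
   variables x and the last l are the quantified variables y. *)
Definition coclone_neq (Gamma : constraint_language) (R : logical_relation) :
  Prop :=
  exists (l : nat) (phi : formula (arity R + l)),
    formula_over Gamma phi /\
    forall x : (arity R).-tuple bool,
      holds x <-> exists y : l.-tuple bool, fsat (cat_tuple x y) phi.

(* <Gamma> *)
Definition coclone (Gamma : constraint_language) : logical_relation -> Prop :=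
  coclone_neq (eq_relation |` Gamma).

(* The literal (i, true) is x_i and (i, false) is its negation. *)
Definition literal (k : nat) := ('I_k * bool)%type.

Definition lsat k (x : k.-tuple bool) (l : literal k) : bool :=
  tnth x l.1 == l.2.

(* A list of literals is read as their disjunction; [::] is false.  Allowing
   the empty clause matters only in arity 0, since otherwise falsity is also
   the conjunction of x_i and its negation. *)
Definition clause (k : nat) := seq (literal k).

Definition clsat k (x : k.-tuple bool) (c : clause k) : bool :=
  has (lsat x) c.

Definition is_literal k (c : clause k) : bool := size c == 1.
Definition positive_clause k (c : clause k) : bool := all (fun l => l.2) c.
Definition negative_clause k (c : clause k) : bool := all (fun l => ~~ l.2) c.

Definition definable_by_clauses (R : logical_relation)
  (P : pred (clause (arity R))) : Prop :=
  exists cs : seq (clause (arity R)),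
    all P cs /\
    forall x : (arity R).-tuple bool, holds x <-> all (clsat x) cs.

Definition strictly_essentially_positive_rel (R : logical_relation) : Prop :=
  @definable_by_clauses R (fun c => is_literal c || positive_clause c).

Definition strictly_essentially_negative_rel (R : logical_relation) : Prop :=
  @definable_by_clauses R (fun c => is_literal c || negative_clause c).

Definition strictly_essentially_positive (Gamma : constraint_language) : Prop :=
  forall R, R \in Gamma -> strictly_essentially_positive_rel R.

Definition strictly_essentially_negative (Gamma : constraint_language) : Prop :=
  forall R, R \in Gamma -> strictly_essentially_negative_rel R.

(* Main.v *)
Require Import Defs.
From mathcomp Require Import all_boot finmap.

(** If a relation R of Gamma is not strictly essentially positive, some x in R
    leaves R when a coordinate i with x_i = 0 is raised to 1, although some w in
    R has w_i = 1; dually for negative.  Identify the variables of R (or of its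
    dual counterpart S) along x.  If R contains the constant tuple 1, or S the
    constant tuple 0, this leaves a reflexive binary relation other than the
    full one, which is equality or an implication.  Otherwise both constants
    are definable (or the disequality x <> y is, and it composes with itself to
    equality).  With constants, identifying variables along the pair (x, w)
    yields equality, disequality or NAND from R, and equality, disequality or
    OR from S; NAND and OR together define disequality. *)

Set Implicit Arguments.
Unset Strict Implicit.
Unset Printing Implicit Defensive.

Local Open Scope fset_scope.

(** * Existentially quantified formulas over arbitrary variable types *)

Definition gconstraint (V : Type) :=
  {R : logical_relation & 'I_(arity R) -> V}.

Definition gsat V (s : V -> bool) (c : gconstraint V) : bool :=
  @holds (tag c) [tuple s (tagged c j) | j < arity (tag c)].

Definition gmap V U (f : V -> U) (c : gconstraint V) : gconstraint U :=
  Tagged (fun R => 'I_(arity R) -> U) (f \o tagged c).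

Definition sum_fun V W T (s : V -> T) (y : W -> T) (z : V + W) : T :=
  match z with inl v => s v | inr w => y w end.

(* Unlike in [coclone_neq], the free variables range over any type, so that
   conjunction and quantification need no arithmetic on indices. *)
Definition pp (Gamma : constraint_language) (V : Type)
  (P : (V -> bool) -> Prop) : Prop :=
  exists (W : finType) (phi : seq (gconstraint (V + W))),
    all (fun c => tag c \in Gamma) phi /\
    forall s, P s <-> exists y : W -> bool, all (gsat (sum_fun s y)) phi.

Lemma eq_gsat V (s t : V -> bool) : s =1 t -> gsat s =1 gsat t.
Proof.
move=> st c; rewrite /gsat; congr holds.
by apply: eq_from_tnth => j; rewrite !tnth_mktuple.
Qed.

Lemma all_gsat_gmap V U (f : V -> U) (s : U -> bool) (t : V -> bool) phi :
  s \o f =1 t -> all (gsat s) (map (gmap f) phi) = all (gsat t) phi.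
Proof. by move=> sft; rewrite all_map; apply: eq_all => c; exact: (eq_gsat sft c). Qed.

Lemma pp_iff Gamma V (P Q : (V -> bool) -> Prop) :
  (forall s, P s <-> Q s) -> pp Gamma P -> pp Gamma Q.
Proof.
move=> PQ [W [phi [Gphi Pphi]]]; exists W, phi; split=> // s.
by split=> [/PQ/Pphi | /Pphi/PQ].
Qed.

Lemma pp_true Gamma V : @pp Gamma V (fun=> True).
Proof. by exists void, [::]; split=> // s; split=> // _; exists (fun=> true). Qed.

Lemma pp_holds Gamma V R (f : 'I_(arity R) -> V) : R \in Gamma ->
  pp Gamma (fun s => @holds R [tuple s (f j) | j < arity R]).
Proof.
move=> GR; exists void,
  [:: Tagged (fun R => 'I_(arity R) -> (V + void)%type) (fun j => inl (f j))].
split=> [|s] /=; first by rewrite GR.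
split=> [Rs|[y /andP [] //]].
by exists (fun=> true); rewrite andbT.
Qed.

Lemma pp_and Gamma V (P Q : (V -> bool) -> Prop) :
  pp Gamma P -> pp Gamma Q -> pp Gamma (fun s => P s /\ Q s).
Proof.
move=> [W1 [phi [Gphi Pphi]]] [W2 [psi [Gpsi Qpsi]]].
(* The quantified variables of the two formulas are kept apart as the two summands of [W1 + W2]. *)
pose f1 := @sum_fun V W1 (V + (W1 + W2)) inl (inr \o inl).
pose f2 := @sum_fun V W2 (V + (W1 + W2)) inl (inr \o inr).
exists (W1 + W2)%type, (map (gmap f1) phi ++ map (gmap f2) psi).
split=> [|s]; first by rewrite all_cat !all_map; apply/andP.
have E1 y : all (gsat (sum_fun s y)) (map (gmap f1) phi)
    = all (gsat (sum_fun s (y \o inl))) phi.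
  by apply: all_gsat_gmap; case.
have E2 y : all (gsat (sum_fun s y)) (map (gmap f2) psi)
    = all (gsat (sum_fun s (y \o inr))) psi.
  by apply: all_gsat_gmap; case.
split=> [[/Pphi [y1 s1] /Qpsi [y2 s2]]|[y]].
  by exists (sum_fun y1 y2); rewrite all_cat E1 E2; apply/andP.
rewrite all_cat E1 E2 => /andP [s1 s2].
by split; [apply/Pphi; exists (y \o inl) | apply/Qpsi; exists (y \o inr)].
Qed.

Lemma pp_exists Gamma V (W : finType) (P : (V + W -> bool) -> Prop) :
  pp Gamma P -> pp Gamma (fun s => exists y, P (sum_fun s y)).
Proof.
move=> [U [phi [Gphi Pphi]]].
pose f := sum_fun (sum_fun inl (inr \o inl)) (inr \o inr)
  : V + W + U -> V + (W + U).
exists (W + U)%type, (map (gmap f) phi).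
split=> [|s]; first by rewrite all_map.
have E y : all (gsat (sum_fun s y)) (map (gmap f) phi)
    = all (gsat (sum_fun (sum_fun s (y \o inl)) (y \o inr))) phi.
  by apply: all_gsat_gmap; do 2?case.
split=> [[y /Pphi [z syz]]|[y]].
  by exists (sum_fun y z); rewrite E.
by rewrite E => syz; exists (y \o inl); apply/Pphi; exists (y \o inr).
Qed.

Lemma coclone_neq_pp Gamma R :
  pp Gamma (fun s : 'I_(arity R) -> bool => @holds R (mktuple s)) ->
  coclone_neq Gamma R.
Proof.
move=> [W [phi [Gphi Rphi]]].
(* Free variables keep their index; quantified ones are numbered after them by their rank in [W]. *)
pose f := sum_fun (@lshift (arity R) #|W|) (@rshift (arity R) #|W| \o enum_rank).
pose F (c : gconstraint ('I_(arity R) + W)) : constraint (arity R + #|W|) :=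
  @Constraint _ (tag c) [tuple f (tagged c j) | j < arity (tag c)].
exists #|W|, (map F phi); split; first by rewrite /formula_over all_map.
move=> x.
have E (y : #|W|.-tuple bool) : fsat (cat_tuple x y) (map F phi)
    = all (gsat (sum_fun (tnth x) (fun w => tnth y (enum_rank w)))) phi.
  rewrite /fsat all_map; apply: eq_all => c; rewrite /gsat /csat /=.
  congr holds; apply: eq_from_tnth => j; rewrite !tnth_mktuple.
  by case: (tagged c j) => z /=; rewrite ?tnth_lshift ?tnth_rshift.
have xE : mktuple (tnth x) = x.
  by apply: eq_from_tnth => j; rewrite tnth_mktuple.
have := Rphi (tnth x); rewrite xE => -[R1 R2].
split=> [/R1 [y xy]|[y xy]]; last by 
  by apply: R2; exists (fun w => tnth y (enum_rank w)); rewrite -E.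
exists (mktuple (y \o enum_val)); rewrite E.
rewrite -(eq_all (@eq_gsat _ (sum_fun (tnth x) y) _ _)) //.
by case=> z //=; rewrite tnth_mktuple /= enum_rankK.
Qed.

Lemma pp_exists1 Gamma V (P : bool -> (V -> bool) -> Prop) :
  pp Gamma (fun s : V + unit -> bool => P (s (inr tt)) (s \o inl)) ->
  pp Gamma (fun s => exists b, P b s).
Proof.
move=> /pp_exists; apply: pp_iff => s.
by split=> [[y Py]|[b Pb]]; [exists (y tt) | exists (fun=> b)].
Qed.

(** * Definable constants and binary relations *)

Definition pp_const Gamma (b : bool) : Prop :=
  forall V (v : V), pp Gamma (fun s => s v = b).

(** As in [pp_const], the variable type is quantified inside, so that the property also applies to a
    type enlarged by auxiliary variables. *)
Definition pp_rel Gamma (T : rel bool) : Prop :=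
  forall V (u v : V), pp Gamma (fun s => T (s u) (s v)).

(* Variables of R may be identified or replaced by the constants in [C]. *)
Lemma pp_minor Gamma (C : pred bool) V R (f : 'I_(arity R) -> V + bool) :
  R \in Gamma -> (forall b, C b -> pp_const Gamma b) ->
  (forall j, sum_fun (fun=> true) C (f j)) ->
  pp Gamma (fun s => @holds R [tuple sum_fun s id (f j) | j < arity R]).
Proof.
move=> GR GC Cf.
(* The variable [inr b] stands for the constant [b] and is forced to it only when [C b]; [f] uses no
   other constants. *)
have ppC b : pp Gamma (fun s : V + bool -> bool => C b -> s (inr b) = b).
  case Cb: (C b); last by apply: pp_iff (pp_true _ _).
  by apply: pp_iff (GC b Cb _ (inr b)) => s; split=> // /(_ isT).
have := pp_exists (pp_and (pp_holds f GR) (pp_and (ppC true) (ppC false))).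
apply: pp_iff => s; split=> [[y [Rs [yt yf]]]|Rs].
  suff E : [tuple sum_fun s id (f j) | j < arity R]
      = [tuple sum_fun s y (f j) | j < arity R] by rewrite E.
  apply: eq_from_tnth => j; rewrite !tnth_mktuple.
  by case: (f j) (Cf j) => //= -[] /=; [move/yt|move/yf].
by exists id.
Qed.

Lemma pp_eq_of_neq Gamma :
  pp_rel Gamma (fun u v => u != v) -> pp_rel Gamma eq_op.
Proof.
move=> Gneq V u v.
have := pp_and (Gneq _ (inl u : V + unit) (inr tt))
               (Gneq _ (inl v : V + unit) (inr tt)).
move/(@pp_exists1 _ _ (fun b s => s u != b /\ s v != b)).
apply: pp_iff => s; split=> [[b]|/eqP <-]; last by exists (~~ s u); case: (s u).
by case: b (s u) (s v) => -[] [] [].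
Qed.

(** Such a [T] is equality or an implication, and T(u, v) together with T(v, u) is equality in both
    cases. *)
Lemma pp_eq_of_rel Gamma (T : rel bool) b : pp_rel Gamma T ->
  T b b -> T (~~ b) (~~ b) -> ~~ T b (~~ b) -> pp_rel Gamma eq_op.
Proof.
move=> GT Tb Tnb nTb V u v; have := pp_and (GT V u v) (GT V v u).
apply: pp_iff => s; move/negbTE: nTb Tb Tnb.
by case: b => /= nT T1 T0; case: (s u); case: (s v); rewrite ?nT ?T1 ?T0;
  split=> // -[].
Qed.

(** * Equality, constants, NAND and OR by identifying variables *)

Definition upd k (x : k.-tuple bool) (i : 'I_k) (b : bool) : k.-tuple bool :=
  [tuple if j == i then b else tnth x j | j < k].

Lemma bool_neqP (a b : bool) : a <> b -> a = ~~ b.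
Proof. by case: a b => -[]. Qed.

(** If [R] contains the constant tuple [~~ b], then R(v, ..., v) says v = [~~ b]. Otherwise it
    contains neither constant tuple, and identifying its variables along [q] gives a relation with
    the pair (true, false) and no diagonal pair: either disequality, or that single pair, whose
    projections define both constants. *)
Lemma const_or_eq Gamma b R (q : (arity R).-tuple bool) :
  R \in Gamma -> holds q -> ~~ @holds R [tuple b | j < arity R] ->
  pp_const Gamma (~~ b) \/ pp_rel Gamma eq_op.
Proof.
move=> GR Rq nRb.
case Rnb: (@holds R [tuple ~~ b | j < arity R]).
  left=> V v; apply: pp_iff (pp_holds (fun=> v) GR) => s.
  case: (s v =P b) => [->|/bool_neqP ->]; last by rewrite Rnb.
  by rewrite (negbTE nRb); split=> //; case: b {nRb Rnb}.
pose T u v := @holds R [tuple if tnth q j then u else v | j < arity R].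
have GT : pp_rel Gamma T.
  move=> V u v; apply: pp_iff (pp_holds (fun j => if tnth q j then u else v) GR).
  move=> s; rewrite /T; suff -> : [tuple s (if tnth q j then u else v) | j < arity R]
    = [tuple if tnth q j then s u else s v | j < arity R] by [].
  by apply: eq_from_tnth => j; rewrite !tnth_mktuple; case: ifP.
have T10 : T true false.
  rewrite /T; suff -> : [tuple if tnth q j then true else false | j < arity R] = q by [].
  by apply: eq_from_tnth => j; rewrite !tnth_mktuple; case: ifP.
have Tcc c : T c c = false.
  rewrite /T; have -> : [tuple if tnth q j then c else c | j < arity R]
    = [tuple c | j < arity R].
    by apply: eq_from_tnth => j; rewrite !tnth_mktuple; case: ifP.
  by case: (c =P b) => [->|/bool_neqP -> //]; apply/negbTE.
case T01: (T false true); [right|left].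
  apply: pp_eq_of_neq => V u v; apply: pp_iff (GT V u v) => s.
  by case: (s u); case: (s v); rewrite ?Tcc ?T10 ?T01.
have GT1 c : pp_const Gamma c.
  case: c => V v.
    have := pp_exists1 (P := fun c s => T (s v) c) (GT _ (inl v) (inr tt)).
    apply: pp_iff => s; split=> [[c]|->]; last by exists false.
    by case: (s v); case: c; rewrite ?Tcc ?T10 ?T01.
  have := pp_exists1 (P := fun c s => T c (s v)) (GT _ (inr tt) (inl v)).
  apply: pp_iff => s; split=> [[c]|->]; last by exists true.
  by case: (s v); case: c; rewrite ?Tcc ?T10 ?T01.
exact: GT1.
Qed.

Lemma eq_of_const_valid Gamma b R (x : (arity R).-tuple bool) i :
  R \in Gamma -> holds x -> tnth x i = ~~ b -> ~~ @holds R (upd x i b) ->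
  @holds R [tuple b | j < arity R] -> pp_rel Gamma eq_op.
Proof.
move=> GR Rx xi nRx Rb.
case Rnb: (@holds R [tuple ~~ b | j < arity R]).
  (* Both diagonal pairs are constant tuples of [R]. Position [i] joins the block where [x] is [b],
     so that (b, ~~ b) spells [upd x i b]. *)
  pose f V (u v : V) j := if (j != i) && (tnth x j == ~~ b) then v else u.
  apply: (@pp_eq_of_rel _ (fun u v => @holds R [tuple f _ u v j | j < arity R]) b).
  - move=> V u v; apply: pp_iff (pp_holds (f V u v) GR) => s.
    suff -> : [tuple s (f V u v j) | j < arity R]
      = [tuple f bool (s u) (s v) j | j < arity R] by [].
    by apply: eq_from_tnth => j; rewrite !tnth_mktuple /f; case: ifP.
  - suff -> : [tuple f _ b b j | j < arity R] = [tuple b | j < arity R] by [].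
    by apply: eq_from_tnth => j; rewrite !tnth_mktuple /f; case: ifP.
  - suff -> : [tuple f _ (~~ b) (~~ b) j | j < arity R]
      = [tuple ~~ b | j < arity R] by [].
    by apply: eq_from_tnth => j; rewrite !tnth_mktuple /f; case: ifP.
  - suff -> : [tuple f _ b (~~ b) j | j < arity R] = upd x i b by [].
    apply: eq_from_tnth => j; rewrite !tnth_mktuple /f.
    case: eqP => //= _; case: eqP => [-> //|].
    by move/bool_neqP; rewrite negbK.
(* Here [b] and [~~ b] exchange roles, and the constant tuple [b] is the known member of [R]. *)
have [] := const_or_eq GR Rb (negbT Rnb); last by [].
rewrite negbK => Gb.
(* Only position [i] takes [u]; with the constant [b] put wherever [x] is [b], the pair (~~ b, ~~ b)
   spells [x] itself. *)
pose f V (u v : V) j : V + bool :=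
  if j == i then inl u else if tnth x j == ~~ b then inl v else inr b.
apply: (@pp_eq_of_rel _
  (fun u v => @holds R [tuple sum_fun id id (f _ u v j) | j < arity R]) b).
- move=> V u v; apply: pp_iff (@pp_minor _ (pred1 b) _ _ (f V u v) GR _ _) => [s||j].
  + suff -> : [tuple sum_fun s id (f V u v j) | j < arity R]
      = [tuple sum_fun id id (f bool (s u) (s v) j) | j < arity R] by [].
    by apply: eq_from_tnth => j; rewrite !tnth_mktuple /f; do 2?case: ifP.
  + by move=> c /eqP ->.
  + by rewrite /f; do 2?case: ifP => //= _; rewrite eqxx.
- suff -> : [tuple sum_fun id id (f _ b b j) | j < arity R]
    = [tuple b | j < arity R] by [].
  by apply: eq_from_tnth => j; rewrite !tnth_mktuple /f; do 2?case: ifP.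
- suff -> : [tuple sum_fun id id (f _ (~~ b) (~~ b) j) | j < arity R] = x by [].
  apply: eq_from_tnth => j; rewrite !tnth_mktuple /f.
  case: eqP => [-> //|_]; case: eqP => [-> //|].
  by move/bool_neqP; rewrite negbK.
- suff -> : [tuple sum_fun id id (f _ b (~~ b) j) | j < arity R] = upd x i b by [].
  apply: eq_from_tnth => j; rewrite !tnth_mktuple /f.
  case: eqP => [//|_]; case: eqP => [-> //|].
  by move/bool_neqP; rewrite negbK.
Qed.

(* The relation [(u != b) || (v != b)] is NAND for [b = true], OR for
   [b = false]. *)
Lemma or_or_eq Gamma b R (x w : (arity R).-tuple bool) i :
  (forall c, pp_const Gamma c) ->
  R \in Gamma -> holds x -> tnth x i = ~~ b -> ~~ @holds R (upd x i b) ->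
  holds w -> tnth w i = b ->
  pp_rel Gamma (fun u v => (u != b) || (v != b)) \/ pp_rel Gamma eq_op.
Proof.
move=> Gc GR Rx xi nRx Rw wi.
(* Positions where [x] and [w] agree become constants. The others split into [i], those where [x]
   falls like [c] from [b] to [~~ b] in [w], and those where it changes the opposite way, like
   [v]. *)
pose f V (u v c : V + bool) j : V + bool :=
  if j == i then u else if tnth x j == tnth w j then inr (tnth x j)
  else if tnth x j == b then c else v.
pose F u v c := @holds R
  [tuple sum_fun id id (f bool (inl u) (inl v) (inl c) j) | j < arity R].
have GF V (u v c : V + bool) :
    pp Gamma (fun s => F (sum_fun s id u) (sum_fun s id v) (sum_fun s id c)).
  have G := @pp_minor _ predT _ _ (f V u v c) GR (fun c _ => Gc c) _.
  apply: pp_iff (G _) => [s|j]; last first.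
    by case: (f V u v c j).
  rewrite /F; suff -> : [tuple sum_fun s id (f V u v c j) | j < arity R]
    = [tuple sum_fun id id (f bool (inl (sum_fun s id u)) (inl (sum_fun s id v))
        (inl (sum_fun s id c)) j) | j < arity R] by [].
  by apply: eq_from_tnth => j; rewrite !tnth_mktuple /f; do 3?case: ifP.
have Fx : F (~~ b) (~~ b) b.
  rewrite /F; suff -> : [tuple sum_fun id id
    (f bool (inl (~~ b)) (inl (~~ b)) (inl b) j) | j < arity R] = x by [].
  apply: eq_from_tnth => j; rewrite !tnth_mktuple /f.
  case: eqP => [-> //|_]; case: eqP => //= _.
  by case: eqP => [-> //|/bool_neqP].
have Fw : F b b (~~ b).
  rewrite /F; suff -> : [tuple sum_fun id id
    (f bool (inl b) (inl b) (inl (~~ b)) j) | j < arity R] = w by [].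
  apply: eq_from_tnth => j; rewrite !tnth_mktuple /f.
  case: eqP => [-> //|_]; case: eqP => //= /nesym/bool_neqP ->.
  by case: eqP => [->|/bool_neqP ->] //=; rewrite negbK.
have nF : ~~ F b (~~ b) b.
  rewrite /F; suff -> : [tuple sum_fun id id
    (f bool (inl b) (inl (~~ b)) (inl b) j) | j < arity R] = upd x i b by [].
  apply: eq_from_tnth => j; rewrite !tnth_mktuple /f.
  case: eqP => [//|_]; case: eqP => //= _.
  by case: eqP => [-> //|/bool_neqP].
(* With [c] fixed to [b], both diagonal pairs are present and (b, ~~ b) is missing. *)
case F1: (F b b b).
  right; apply: (@pp_eq_of_rel _ (fun u v => F u v b) b) => // V u v.
  exact: (GF V (inl u) (inl v) (inr b)).
have GT V (u v : V) := GF V (inl u) (inl u) (inl v).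
have bnb : (b == ~~ b) = false by case: (b).
have nbb : (~~ b == b) = false by case: (b).
(* F(u, u, v) contains both off-diagonal pairs but not (b, b); the pair (~~ b, ~~ b) separates NAND
   or OR from disequality. *)
case F0: (F (~~ b) (~~ b) (~~ b)); [left=> V u v|right].
  apply: pp_iff (GT V u v) => s /=.
  by case: (s u =P b) => [->|/bool_neqP ->]; case: (s v =P b) => [->|/bool_neqP ->];
    rewrite ?Fx ?Fw ?F1 ?F0 ?eqxx ?nbb.
apply: pp_eq_of_neq => V u v; apply: pp_iff (GT V u v) => s /=.
by case: (s u =P b) => [->|/bool_neqP ->]; case: (s v =P b) => [->|/bool_neqP ->];
  rewrite ?Fx ?Fw ?F1 ?F0 ?eqxx ?nbb ?bnb.
Qed.

(** * Obstructions to strict essential positivity and negativity *)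

(* [b = true] is the positive case, [b = false] the negative one. *)
Definition strictly_essential (b : bool) (R : logical_relation) : Prop :=
  @definable_by_clauses R (fun c => is_literal c || all (fun l => l.2 == b) c).

Definition obstruction (b : bool) (R : logical_relation) : bool :=
  [exists x : (arity R).-tuple bool, exists w : (arity R).-tuple bool,
   exists i, [&& holds x, tnth x i == ~~ b, ~~ @holds R (upd x i b),
                 holds w & tnth w i == b]].

(** Without an obstruction, [R] is closed under switching to [b] any coordinate that is not
    constantly [~~ b] on [R]. Literals for the constant coordinates, and one clause for each tuple
    lying above no member of [R], then define [R]. *)
Lemma no_obstruction b R : ~~ obstruction b R -> strictly_essential b R.
Proof.
move=> noR.
have step (x w : (arity R).-tuple bool) i : holds x -> tnth x i = ~~ b ->
    holds w -> tnth w i = b -> @holds R (upd x i b).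
  move=> Rx xi Rw wi; apply: contraNT noR => nRx.
  apply/existsP; exists x; apply/existsP; exists w; apply/existsP; exists i.
  by rewrite Rx xi nRx Rw wi !eqxx.
(* The coordinatewise order with [~~ b] below [b]: [y] arises from [z] by switching coordinates to
   [b]. *)
pose le (z y : (arity R).-tuple bool) :=
  [forall j, (tnth y j == ~~ b) ==> (tnth z j == ~~ b)].
pose Z i := [forall w : (arity R).-tuple bool, holds w ==> (tnth w i == ~~ b)].
(* Induction on a bound for the number of coordinates where [z] and [y] differ, switching one of
   them in [z] at each step. *)
have up n (z y : (arity R).-tuple bool) : #|[set j | tnth z j != tnth y j]| <= n ->
    holds z -> le z y -> (forall i, Z i -> tnth y i = ~~ b) -> holds y.
  elim: n z => [|n IHn] z.
    rewrite leqn0 cards_eq0 => /eqP zy Rz _ _.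
    suff -> : y = z by [].
    apply: eq_from_tnth => j; apply/eqP; rewrite eq_sym.
    by move/setP/(_ j): zy; rewrite !inE => /negbFE.
  move=> zyn Rz /forallP zy yZ.
  case: (pickP (fun j => tnth z j != tnth y j)) => [j zyj|zy0]; last first.
    suff -> : y = z by [].
    by apply: eq_from_tnth => j; apply/eqP; rewrite eq_sym; move: (zy0 j) => /negbFE.
  have yj : tnth y j = b.
    case: (tnth y j =P b) => // /bool_neqP yj.
    by move: (zy j) zyj; rewrite yj eqxx /= => ->.
  have zj : tnth z j = ~~ b by apply: bool_neqP => zj; rewrite zj yj eqxx in zyj.
  have [w Rw wj] : exists2 w : (arity R).-tuple bool, holds w & tnth w j = b.
    have : ~~ Z j by apply/negP => /yZ; rewrite yj; case: (b).
    rewrite negb_forall => /existsP [w]; rewrite negb_imply => /andP [Rw /eqP].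
    by move/bool_neqP; rewrite negbK; exists w.
  apply: (IHn (upd z j b)) => //; last 1 first.
  - apply/forallP => k; rewrite tnth_mktuple; case: (k =P j) => [->|_]; last exact: zy.
    by rewrite yj implybb.
  - rewrite -ltnS; apply: leq_trans zyn; apply: proper_card.
    apply/properP; split; last by exists j; rewrite !inE // tnth_mktuple eqxx yj eqxx.
    apply/subsetP => k; rewrite !inE tnth_mktuple; case: (k =P j) => // ->.
    by rewrite yj eqxx.
  - exact: step Rz zj Rw wj.
pose lits := [seq [:: (i, ~~ b)] | i <- enum Z].
pose bad (y : (arity R).-tuple bool) :=
  [forall z : (arity R).-tuple bool, holds z ==> ~~ le z y].
(* This clause fails exactly on the tuples below [y]. It is empty when [y] is constantly [b], which
   is bad only if [R] is empty. *)
pose cl (y : (arity R).-tuple bool) :=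
  [seq (j, b) | j <- enum (fun j => tnth y j == ~~ b)].
exists (lits ++ [seq cl y | y <- enum bad]); split.
  rewrite all_cat; apply/andP; split.
    by apply/allP => c /mapP [i _ ->].
  apply/allP => c /mapP [y _ ->]; apply/orP; right.
  by apply/allP => l /mapP [j _ ->] /=.
have clP x y : clsat x (cl y) = ~~ le x y.
  rewrite negb_forall; apply/hasP/existsP => [[l /mapP [j]]|[j]].
    rewrite mem_enum => yj -> xj; exists j; move: yj xj.
    by rewrite /lsat unfold_in /= => -> /eqP ->; case: (b).
  rewrite negb_imply => /andP [yj /eqP/bool_neqP]; rewrite negbK => xj.
  exists (j, b); first by apply/mapP; exists j; rewrite // mem_enum.
  by rewrite /lsat /= xj.
move=> x; split=> [Rx|/allP xcs].
  apply/allP => c; rewrite mem_cat => /orP [] /mapP [].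
    move=> i; rewrite mem_enum => /forallP /(_ x) /implyP /(_ Rx) xi ->.
    by rewrite /= /lsat xi.
  by move=> y; rewrite mem_enum => /forallP /(_ x) /implyP /(_ Rx); rewrite -clP => xy ->.
have xZ i : Z i -> tnth x i = ~~ b.
  move=> Zi; have := xcs [:: (i, ~~ b)]; rewrite mem_cat map_f ?mem_enum //.
  by move=> /(_ isT); rewrite /= orbF => /eqP.
(* A bad [x] would violate its own clause, since it lies below itself. *)
case badx: (bad x).
  have := xcs (cl x); rewrite mem_cat orbC map_f ?mem_enum // clP => /(_ isT).
  by case/negP; apply/forallP => j; apply/implyP.
move/negbT: badx; rewrite negb_forall => /existsP [z].
rewrite negb_imply negbK => /andP [Rz zx].
exact: up (leqnn _) Rz zx xZ.
Qed.

(** [Gamma] is finite and [obstruction] is boolean, so a witness is found without excluded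
    middle. *)
Lemma has_obstruction (b : bool) (Gamma : constraint_language) :
  ~ (forall R, R \in Gamma -> strictly_essential b R) ->
  exists2 R : logical_relation, R \in Gamma & obstruction b R.
Proof.
move=> nG; apply/(@hasP _ (obstruction b) (enum_fset Gamma)).
apply/negPn/negP; rewrite -all_predC => /allP allG.
by apply: nG => R GR; apply: no_obstruction; apply: allG.
Qed.

(** * Equality is definable, and the two closures coincide *)

Lemma pp_eq Gamma : ~ strictly_essentially_positive Gamma ->
  ~ strictly_essentially_negative Gamma -> pp_rel Gamma eq_op.
Proof.
move=> nP nN.
have [R GR /existsP [x /existsP [w /existsP [i]]]] :
    exists2 R : logical_relation, R \in Gamma & obstruction true R.
  apply: has_obstruction => ess; apply: nP => R /ess [cs [csP Rcs]].
  exists cs; split=> //.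
  apply: sub_all csP => c /=; congr (_ || _); apply: eq_all => l; exact: eqb_id.
case/and5P => Rx /eqP xi nRx Rw /eqP wi.
have [S GS /existsP [y /existsP [z /existsP [j]]]] :
    exists2 S, S \in Gamma & obstruction false S.
  apply: has_obstruction => ess; apply: nN => S /ess [cs [csP Scs]].
  exists cs; split=> //.
  apply: sub_all csP => c /=; congr (_ || _); apply: eq_all => l; exact: eqbF_neg.
case/and5P => Sy /eqP yj nSy Sz /eqP zj.
case R1: (@holds R [tuple true | j < arity R]).
  exact: eq_of_const_valid GR Rx xi nRx R1.
case S0: (@holds S [tuple false | j < arity S]).
  exact: eq_of_const_valid GS Sy yj nSy S0.
(* [R] omits the all-true tuple and supplies the constant false; [S] omits the all-false tuple and
   supplies the constant true. *)
have [G0|//] := const_or_eq GR Rx (negbT R1).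
have [G1|//] := const_or_eq GS Sy (negbT S0).
have Gc c : pp_const Gamma c by case: c.
have [Gnand|//] := or_or_eq Gc GR Rx xi nRx Rw wi.
have [Gor|//] := or_or_eq Gc GS Sy yj nSy Sz zj.
apply: pp_eq_of_neq => V u v; apply: pp_iff (pp_and (Gnand V u v) (Gor V u v)) => s.
by case: (s u); case: (s v); split=> // -[].
Qed.

Lemma coclone_neq_sub (Gamma Delta : constraint_language) R :
  Gamma `<=` Delta -> coclone_neq Gamma R -> coclone_neq Delta R.
Proof.
move=> /fsubsetP sGD [l [phi [Gphi Rphi]]]; exists l, phi; split=> //.
by apply: sub_all Gphi => c; apply: sGD.
Qed.

(** Each equality constraint is replaced by its definition over [Gamma], whose auxiliary variables
    are quantified along with the rest. *)
Lemma coclone_neq_eq Gamma R :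
  pp_rel Gamma eq_op -> coclone Gamma R -> coclone_neq Gamma R.
Proof.
move=> Geq [l [phi [Gphi Rphi]]]; apply: coclone_neq_pp.
have ppc (c : constraint (arity R + l)) : crel c \in eq_relation |` Gamma ->
    pp Gamma (fun s : 'I_(arity R) + 'I_l -> bool => csat (mktuple (s \o split)) c).
  case: c => Q a /=; rewrite in_fset1U => /orP [/eqP EQ|GQ].
    subst Q; apply: pp_iff (Geq _ (split (tnth a ord0)) (split (tnth a ord_max))) => s.
    by rewrite /csat /holds inE !tnth_mktuple.
  apply: pp_iff (pp_holds (fun j => split (tnth a j)) GQ) => s.
  rewrite /csat /=; suff -> : [tuple tnth (mktuple (s \o split)) (tnth a j) | j < arity Q]
    = [tuple s (split (tnth a j)) | j < arity Q] by [].
  by apply: eq_from_tnth => j; rewrite !tnth_mktuple.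
have ppphi : pp Gamma
    (fun s : 'I_(arity R) + 'I_l -> bool => fsat (mktuple (s \o split)) phi).
  elim: phi Gphi {Rphi} => [_|c phi IHphi /andP [Gc /IHphi ppphi]].
    by apply: pp_iff (pp_true _ _).
  apply: pp_iff (pp_and (ppc c Gc) ppphi) => s.
  by split=> /andP.
have E (x : 'I_(arity R) -> bool) (y : 'I_l -> bool) :
    mktuple (sum_fun x y \o split) = cat_tuple (mktuple x) (mktuple y).
  apply: eq_from_tnth => j; rewrite tnth_mktuple /=.
  by case: split_ordP => k ->; rewrite ?tnth_lshift ?tnth_rshift tnth_mktuple.
apply: pp_iff (pp_exists ppphi) => x; split=> [[y]|/Rphi [y xy]].
  by rewrite E => xy; apply/Rphi; exists (mktuple y).
exists (tnth y); rewrite E.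
suff -> : mktuple (tnth y) = y by [].
by apply: eq_from_tnth => j; rewrite tnth_mktuple.
Qed.

Theorem lemma13 (Gamma : constraint_language)
  (hpos : ~ strictly_essentially_positive Gamma)
  (hneg : ~ strictly_essentially_negative Gamma) :
  coclone_neq Gamma eq_relation /\
  (forall R : logical_relation, coclone Gamma R <-> coclone_neq Gamma R).
Proof.
have Geq := pp_eq hpos hneg; split=> [|R]; last first.
  split; first exact: coclone_neq_eq.
  by apply: coclone_neq_sub; apply: fsubsetU1.
apply: coclone_neq_pp; apply: pp_iff (Geq _ ord0 ord_max) => s.
by rewrite /holds inE !tnth_mktuple.
Qed.
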